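(* Let $n\ge 4$, let $\mathsf{L}\colon \mathsf{K}^2\times[0,1]^2\to\mathsf{K}$, and assume that $\prec$ is compatible with $\oplus$. The following monotonicity condition holds: for all $\mathbf{X},\mathbf{Z}\in\mathsf{K}^n$ with $\mathbf{X}\preceq_{(n)}\mathbf{Z}$, $\mathcal{C}_{\preceq,\sigma,\mathsf{L}}(\mathbf{X},\mu)\preceq\mathcal{C}_{\preceq,\tau,\mathsf{L}}(\mathbf{Z},\mu)$ for any $\sigma\in\Pi_{\mathbf{X}}$, $\tau\in\Pi_{\mathbf{Z}}$ and $\mu\in\mathbf{M}$, if and only if all of the following are satisfied: (a) the $\mathcal{C}_{\preceq}$-operator is well defined; (b) for any $\mathbf{u},\mathbf{v}\in\mathsf{K}$ with $\mathbf{u}\preceq\mathbf{v}$ and $b_1,b_2,b_3\in[0,1]$ with $b_3\le b_2\le b_1$, the function $[\mathbf{u},\mathbf{v}]_{\mathsf{K}}\ni\mathbf{x}\mapsto \mathsf{L}(\mathbf{x},\mathbf{u},b_1,b_2)\oplus \mathsf{L}(\mathbf{v},\mathbf{x},b_2,b_3)$ is non-decreasing w.r.t. $\preceq$; (c) for any $\mathbf{u}\in\mathsf{K}$ and $b\in[0,1]$, the function $[\mathbf{u},\mathbf{1}]_{\mathsf{K}}\ni\mathbf{x}\mapsto \mathsf{L}(\mathbf{x},\mathbf{u},b,0)$ is non-decreasing w.r.t. $\preceq$.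
   Context: Setting: $\mathsf{U}$ is a non-empty set with a partial order $\preceq_{\mathrm{p}}$ and a commutative associative binary operation $\oplus\colon\mathsf{U}\times\mathsf{U}\to\mathsf{U}$ (called addition). A total order $\preceq$ on $\mathsf{U}$ is an admissible order w.r.t. $\preceq_{\mathrm{p}}$ if $\mathbf{x}\preceq_{\mathrm{p}}\mathbf{z}$ implies $\mathbf{x}\preceq\mathbf{z}$; $\preceq$ is such an order, and $\mathbf{x}\prec\mathbf{z}$ means $\mathbf{x}\preceq\mathbf{z}$ and $\mathbf{x}\ne\mathbf{z}$. $\mathsf{K}\subseteq\mathsf{U}$ is a non-empty set having a least element $\mathbf{0}$ and a greatest element $\mathbf{1}$ w.r.t. $\preceq_{\mathrm{p}}$ (both in $\mathsf{K}$), with $\mathbf{0}\preceq_{\mathrm{p}}\mathbf{1}$ and $\mathbf{0}\ne\mathbf{1}$. $\prec$ is compatible with $\oplus$ if $\mathbf{x}_1\prec\mathbf{x}_2$ implies $\mathbf{x}_1\oplus\mathbf{v}\prec\mathbf{x}_2\oplus\mathbf{v}$ for all $\mathbf{x}_1,\mathbf{x}_2,\mathbf{v}\in\mathsf{U}$. $[n]=\{1,\dots,n\}$. $\mathbf{M}$ is the set of capacities on $[n]$: $\mu\colon 2^{[n]}\to[0,1]$ with $\mu(C)\le\mu(D)$ for $C\subset D$, $\mu(\varnothing)=0$, $\mu([n])=1$. For $\mathbf{X},\mathbf{Z}\in\mathsf{U}^n$, $\mathbf{X}\preceq_{(n)}\mathbf{Z}$ means $\mathbf{x}_i\preceq\mathbf{z}_i$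 for all $i\in[n]$. For $\mathbf{X}=(\mathbf{x}_1,\dots,\mathbf{x}_n)\in\mathsf{K}^n$, $\Pi_{\mathbf{X}}$ is the set of permutations $\sigma$ of $[n]$ with $\mathbf{x}_{\sigma(1)}\preceq\dots\preceq\mathbf{x}_{\sigma(n)}$. The $\mathcal{C}_{\preceq}$-operator is $\mathcal{C}_{\preceq,\sigma,\mathsf{L}}(\mathbf{X},\mu)=\bigoplus_{i=1}^n \mathsf{L}(\mathbf{x}_{\sigma(i)},\mathbf{x}_{\sigma(i-1)},\mu(B_{\sigma(i)}),\mu(B_{\sigma(i+1)}))$ for $\sigma\in\Pi_{\mathbf{X}}$, with $\mathbf{x}_{\sigma(0)}=\mathbf{0}$, $B_{\sigma(i)}=\{\sigma(i),\dots,\sigma(n)\}$ for $i\in[n]$, $B_{\sigma(n+1)}=\varnothing$. It is well defined if, for every $\mathbf{X}\in\mathsf{K}^n$ and $\mu\in\mathbf{M}$, the value is the same for all $\sigma\in\Pi_{\mathbf{X}}$. For $\mathbf{u},\mathbf{v}\in\mathsf{U}$, $[\mathbf{u},\mathbf{v}]_{\mathsf{K}}=\{\mathbf{x}\in\mathsf{K}:\mathbf{u}\preceq\mathbf{x}\preceq\mathbf{v}\}$. A function $\mathsf{H}\colon\mathsf{K}_0\to\mathsf{U}$ with $\mathsf{K}_0\subseteq\mathsf{K}$ is non-decreasing w.r.t. $\preceq$ if $\mathbf{x}_1\preceq\mathbf{x}_2$ implies $\mathsf{H}(\mathbf{x}_1)\preceq\mathsf{H}(\mathbf{x}_2)$.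 *)

(* Defs.v *)
From HB Require Import structures.
From mathcomp Require Import all_boot all_order all_fingroup all_algebra.
From mathcomp Require Import boolp classical_sets reals.

Set Implicit Arguments.
Unset Strict Implicit.
Unset Printing Implicit Defensive.

Import Order.TTheory GRing.Theory Num.Theory.
Local Open Scope ring_scope.

Definition partial_order (U : Type) (lep : rel U) : Prop :=
  [/\ reflexive lep, antisymmetric lep & transitive lep].

(* The order of the orderType U is admissible with respect to lep. *)
Definition admissible (d : Order.disp_t) (U : orderType d) (lep : rel U) :
    Prop :=
  forall x z : U, lep x z -> (x <= z)%O.

Definition least_in (U : Type) (lep : rel U) (K : set U) (a : U) : Prop :=
  K a /\ forall x, K x -> lep a x.

Definition greatest_in (U : Type) (lep : rel U) (K : set U) (a : U) : Prop :=
  K a /\ forall x, K x -> lep x a.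

Definition lt_compatible (d : Order.disp_t) (U : orderType d)
    (add : U -> U -> U) : Prop :=
  forall x1 x2 v : U, (x1 < x2)%O -> (add x1 v < add x2 v)%O.

Definition unit_itv (R : realType) : set R := [set b | 0 <= b <= 1]%classic.

Definition capacity (R : realType) (n : nat) (mu : {set 'I_n} -> R) : Prop :=
  [/\ forall C, unit_itv (mu C),
      forall C D : {set 'I_n}, C \subset D -> mu C <= mu D,
      mu finset.set0 = 0 & mu [set: 'I_n] = 1].

(* K^n inside U^n, with U^n represented by the functions 'I_n -> U. *)
Definition cartesian_power (U : Type) (n : nat) (K : set U) : set ('I_n -> U) :=
  [set X | forall i, K (X i)]%classic.

Definition le_vec (d : Order.disp_t) (U : orderType d) (n : nat)
    (X Z : 'I_n -> U) : Prop :=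
  forall i, (X i <= Z i)%O.

(* The sequence x_{s(1)}, ..., x_{s(n)}. *)
Definition perm_vals (U : Type) (n : nat) (X : 'I_n -> U) (s : 'S_n) : seq U :=
  [seq X (s j) | j <- enum 'I_n].

Definition sorting_perms (d : Order.disp_t) (U : orderType d) (n : nat)
    (X : 'I_n -> U) : {set 'S_n} :=
  [set s | sorted <=%O (perm_vals X s)].

(* x_{s(k)} for 0 <= k <= n, where x_{s(0)} = zero.  Positions k run over
   1, ..., n as in the mathematical notation, so position k corresponds to the
   ordinal k - 1. *)
Definition perm_val (U : Type) (zero : U) (n : nat) (X : 'I_n -> U) (s : 'S_n)
    (k : nat) : U :=
  nth zero (zero :: perm_vals X s) k.

(* B_{s(k)} = {s(k), ..., s(n)} with k counted from 1; it is empty for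
   k = n + 1. *)
Definition perm_tail (n : nat) (s : 'S_n) (k : nat) : {set 'I_n} :=
  [set s j | j : 'I_n & (k <= j.+1)%N].

(* F 1 + (F 2 + (... + F n)) for n >= 1: the operation need not have a neutral
   element, so the last term serves as the initial value of the big operator. *)
Definition semigroup_sum (U : Type) (add : U -> U -> U) (n : nat)
    (F : nat -> U) : U :=
  \big[add/F n]_(1 <= i < n) F i.

Definition C_op (R : realType) (U : Type) (add : U -> U -> U) (zero : U)
    (L : U -> U -> R -> R -> U) (n : nat) (s : 'S_n) (X : 'I_n -> U)
    (mu : {set 'I_n} -> R) : U :=
  semigroup_sum add n (fun i =>
    L (perm_val zero X s i) (perm_val zero X s i.-1)
      (mu (perm_tail s i)) (mu (perm_tail s i.+1))).

Definition C_well_defined (R : realType) (d : Order.disp_t) (U : orderType d)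
    (add : U -> U -> U) (K : set U) (zero : U) (L : U -> U -> R -> R -> U)
    (n : nat) : Prop :=
  forall (X : 'I_n -> U) (mu : {set 'I_n} -> R),
    cartesian_power K X -> capacity mu ->
    forall s t : 'S_n, s \in sorting_perms X -> t \in sorting_perms X ->
      C_op add zero L s X mu = C_op add zero L t X mu.

Definition itv_in (d : Order.disp_t) (U : orderType d) (K : set U) (u v : U) :
    set U :=
  [set x | K x /\ (u <= x <= v)%O]%classic.

Definition nondecreasing_on (d : Order.disp_t) (U : orderType d) (A : set U)
    (H : U -> U) : Prop :=
  {in A &, {homo H : x1 x2 / (x1 <= x2)%O}}.

(* Main.v *)
(* Compatibility of < with the addition makes the addition cancellative for <=,
   so changing the k-th value of a sorted vector compares the two sums through
   the k-th and (k+1)-st terms alone, or through the last term alone if k = n.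

   Necessity of (b) and (c): choose the sorted vectors (u, x, v, ..., v) and
   (u, ..., u, x), and a capacity with prescribed values on the chain of the
   tails {k, ..., n}; n >= 4 leaves room for b1, b2, b3 between the forced
   values 1 and 0.

   Sufficiency: if one permutation sorts both X and Z, raise the values one at
   a time, starting from the largest.  In general connect X to Z by the vectors
   min(Z, max(X, w)), where w runs through the sorted values of X and Z:
   consecutive ones are sorted by a common permutation, and (a) allows one to
   change the permutation at each vector. *)

Require Import Defs.
From HB Require Import structures.
From mathcomp Require Import all_boot all_order all_fingroup all_algebra.
From mathcomp Require Import boolp classical_sets reals.

Set Implicit Arguments.
Unset Strict Implicit.
Unset Printing Implicit Defensive.

Import Order.TTheory GRing.Theory Num.Theory.
Local Open Scope ring_scope.

(** * Cancellation in ordered sums, and monotonicity along sorted sequences *)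

Section ValueSums.
Variables (R : realType) (d : Order.disp_t) (U : orderType d).
Variables (add : SemiGroup.com_law U) (L : U -> U -> R -> R -> U).
Hypothesis add_compatible : lt_compatible add.

(** On a total order a strictly increasing map also reflects the order; this is the cancellation law
    behind all comparisons of sums below. *)
Lemma le_addl (v : U) : {mono (add^~ v) : x y / (x <= y)%O}.
Proof. by apply: le_mono => x y; apply: add_compatible. Qed.

Lemma le_addr (v : U) : {mono add v : x y / (x <= y)%O}.
Proof. by move=> x y; rewrite ![add v _]SemiGroup.opC le_addl. Qed.

Lemma le_big_add (I : Type) (x y : U) (r : seq I)
    (F : I -> U) :
  (\big[add/x]_(i <- r) F i <= \big[add/y]_(i <- r) F i)%O = (x <= y)%O.
Proof.
by elim: r => [|i r IHr]; rewrite ?big_nil // !big_cons le_addr.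
Qed.

(** Without a neutral element the tail cannot be a separate factor, so it becomes the initial value
    of the head. *)
Lemma semigroup_sum_cat (n k : nat) (F : nat -> U) : (0 < k <= n)%N ->
  semigroup_sum add n F =
  \big[add/(\big[add/F n]_(k <= i < n) F i)]_(1 <= i < k) F i.
Proof.
case/andP=> k_gt0 le_kn; rewrite /semigroup_sum -big_cat_nested /index_iota.
by congr bigop; rewrite -[n in LHS](subnKC le_kn) -addnBAC // iotaD subnKC.
Qed.

Lemma le_semigroup_sum_last (n : nat) (F G : nat -> U) : (0 < n)%N ->
    (forall i, (0 < i < n)%N -> F i = G i) ->
  (semigroup_sum add n F <= semigroup_sum add n G)%O = (F n <= G n)%O.
Proof.
move=> n_gt0 eqFG; rewrite /semigroup_sum.
by rewrite (eq_big_nat _ _ eqFG) le_big_add.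
Qed.

Lemma le_semigroup_sum_pair (n k : nat) (F G : nat -> U) : (0 < k < n)%N ->
    (forall i, (0 < i <= n)%N -> i != k -> i != k.+1 -> F i = G i) ->
  (semigroup_sum add n F <= semigroup_sum add n G)%O =
  (add (F k) (F k.+1) <= add (G k) (G k.+1))%O.
Proof.
case/andP=> k_gt0 lt_kn eqFG.
rewrite !(@semigroup_sum_cat n k) ?k_gt0 ?(ltnW lt_kn) //.
rewrite (@eq_big_nat _ _ _ 1 k F G); last first.
  move=> i /andP[i_gt0 lt_ik]; have lt_in := ltn_trans lt_ik lt_kn.
  by apply: eqFG; rewrite ?i_gt0 1?ltnW // neq_ltn ?lt_ik // ltnS ltnW.
rewrite le_big_add !(@big_ltn _ _ _ k n) //.
(* If [k.+1 = n], the second term of the pair is the initial value itself and nothing is left to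
   cancel on the right. *)
have [lt_Skn|] := ltnP k.+1 n; last first.
  move=> le_nSk; have -> : n = k.+1 by apply/eqP; rewrite eqn_leq le_nSk.
  by rewrite !big_geq.
rewrite !(big_ltn lt_Skn) !SemiGroup.opA.
rewrite (@eq_big_nat _ _ _ k.+2 n F G); last first.
  move=> i /andP[lt_Ski lt_in].
  by apply: eqFG; rewrite ?(ltnW lt_in) ?(leq_trans _ lt_Ski) // neq_ltn
     ?(ltnW lt_Ski) ?lt_Ski orbT.
by rewrite (eqFG n) ?le_addl ?leqnn ?(ltn_trans k_gt0) // neq_ltn ?lt_kn ?lt_Skn orbT.
Qed.

(** The operator with permutation and capacity abstracted away: [a i] stands for x_{s(i)}, with
    [a 0] for x_{s(0)}, and [w i] for the capacity of B_{s(i)}. *)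
Definition val_sum (w : nat -> R) (n : nat) (a : nat -> U) : U :=
  semigroup_sum add n (fun i => L (a i) (a i.-1) (w i) (w i.+1)).

Lemma le_val_sum_last (w : nat -> R) (n : nat) (a a' : nat -> U) :
    (0 < n)%N -> (forall i, (i < n)%N -> a i = a' i) ->
  (val_sum w n a <= val_sum w n a')%O =
  (L (a n) (a n.-1) (w n) (w n.+1) <= L (a' n) (a n.-1) (w n) (w n.+1))%O.
Proof.
move=> n_gt0 eqa; rewrite le_semigroup_sum_last // => [|i /andP[i_gt0 lt_in]].
  by rewrite (eqa n.-1) // prednK.
by rewrite !eqa // (leq_ltn_trans (leq_pred i)).
Qed.

(** The value [a k] enters only the terms [k] and [k.+1]; all others cancel. *)
Lemma le_val_sum_update (w : nat -> R) (n k : nat) (a a' : nat -> U) :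
    (0 < k < n)%N -> (forall i, (i <= n)%N -> i != k -> a i = a' i) ->
  (val_sum w n a <= val_sum w n a')%O =
  (add (L (a k) (a k.-1) (w k) (w k.+1)) (L (a k.+1) (a k) (w k.+1) (w k.+2))
   <= add (L (a' k) (a k.-1) (w k) (w k.+1))
          (L (a k.+1) (a' k) (w k.+1) (w k.+2)))%O.
Proof.
case/andP=> k_gt0 lt_kn eqa.
rewrite (@le_semigroup_sum_pair n k) ?k_gt0 //= => [|i /andP[i_gt0 le_in] ik iSk].
  by rewrite (eqa k.-1) ?(eqa k.+1) // ?neq_ltn ?prednK ?leqnn ?orbT //
     (leq_trans (leq_pred k)) // ltnW.
by rewrite !eqa ?(leq_trans (leq_pred i)) // -eqSS prednK.
Qed.

Variable K : set U.

Lemma le_val_sum (w : nat -> R) (n : nat) (a a' : nat -> U) (one : U) :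
    (0 < n)%N ->
    (forall x, K x -> (x <= one)%O) ->
    (forall (u v : U) (b1 b2 b3 : R), K u -> K v -> (u <= v)%O ->
        unit_itv b1 -> unit_itv b2 -> unit_itv b3 -> b3 <= b2 -> b2 <= b1 ->
        nondecreasing_on (itv_in K u v)
          (fun x => add (L x u b1 b2) (L v x b2 b3))) ->
    (forall (u : U) (b : R), K u -> unit_itv b ->
        nondecreasing_on (itv_in K u one) (fun x => L x u b 0)) ->
    (forall i, unit_itv (w i)) ->
    (forall i, w i.+1 <= w i) -> w n.+1 = 0 ->
    (forall i, K (a i)) -> (forall i, K (a' i)) ->
    (forall i, (i < n)%N -> (a i <= a i.+1)%O) ->
    (forall i, (i < n)%N -> (a' i <= a' i.+1)%O) ->
    a 0%N = a' 0%N -> (forall i, (i <= n)%N -> (a i <= a' i)%O) ->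
  (val_sum w n a <= val_sum w n a')%O.
Proof.
move=> n_gt0 le_one mono_mid mono_last w01 w_decr wn0 Ka Ka' a_sorted a'_sorted.
move=> eq0 le_aa'.
(* The values of a are raised to those of a' one at a time, from the last to
   the first, so that the sequence remains sorted. *)
pose h k i := if (i < k)%N then a i else a' i.
have h_step k : (k < n)%N -> (val_sum w n (h k.+2) <= val_sum w n (h k.+1))%O.
  move=> lt_kn.
  have eqh i : i != k.+1 -> h k.+2 i = h k.+1 i.
    by move=> ne_i; rewrite /h ltnS leq_eqVlt (negPf ne_i).
  have hk : h k.+2 k = a k by rewrite /h ltnW.
  have hSk : h k.+2 k.+1 = a k.+1 by rewrite /h ltnSn.
  have hSk' : h k.+1 k.+1 = a' k.+1 by rewrite /h ltnn.
  have le_ak := a_sorted k lt_kn.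
  have le_aa'k := le_aa' k.+1 lt_kn.
  have [ltSkn|geSkn] := ltnP k.+1 n.
    rewrite (@le_val_sum_update w n k.+1) //= => [|i _]; last exact: eqh.
    rewrite hk hSk hSk' /h ltnn.
    have le_a'k := a'_sorted _ ltSkn.
    (* Position [k.+2] already holds [a' k.+2], which bounds both [a k.+1] and [a' k.+1]; [a k.+2]
       need not bound the latter, hence the order of the updates. *)
    apply: mono_mid => //; rewrite ?inE /=; do ?split => //.
    - exact: (le_trans le_ak (le_trans le_aa'k le_a'k)).
    - by rewrite le_ak (le_trans le_aa'k).
    - by rewrite (le_trans le_ak).
  have Dn : n = k.+1 by apply/eqP; rewrite eqn_leq geSkn.
  rewrite le_val_sum_last // => [|i lt_in]; last by rewrite eqh // -Dn neq_ltn lt_in.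
  rewrite wn0 Dn /= hk hSk hSk'.
  apply: mono_last => //; rewrite ?inE /=; do ?split => //.
  - by rewrite le_ak le_one.
  - by rewrite (le_trans le_ak) // le_one.
have h_le j : (j <= n)%N -> (val_sum w n (h n.+1) <= val_sum w n (h (n - j).+1))%O.
  elim: j => [|j IHj] lt_jn; first by rewrite subn0.
  apply: le_trans (IHj (ltnW lt_jn)) _.
  by rewrite -subSS subSn // h_step // -[n in (_ < n)%N](subnK lt_jn)
     addnS ltnS leq_addr.
have -> : val_sum w n a = val_sum w n (h n.+1).
  rewrite /val_sum /semigroup_sum /h ltnSn (leq_ltn_trans (leq_pred n)) //.
  apply: eq_big_nat => i /andP[_ lt_in].
  by rewrite (leq_ltn_trans (leq_pred i)) ltnS ltnW.
have -> : val_sum w n a' = val_sum w n (h (n - n).+1).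
  (* [h 1] still takes its value at 0 from [a], where [eq0] makes it agree with [a']. *)
  rewrite subnn /val_sum; have eqa' i : h 1%N i = a' i by case: i.
  rewrite /semigroup_sum !eqa'; apply: eq_big_nat => i _.
  by rewrite !eqa'.
exact: h_le.
Qed.

End ValueSums.

(** * Permutations that sort a vector *)

Section SortingPermutations.
Variables (d : Order.disp_t) (U : orderType d).
Variables (n : nat) (zero : U).
Implicit Types (X Z : 'I_n -> U) (s : 'S_n).

Lemma perm_valS X s (j : 'I_n) : perm_val zero X s j.+1 = X (s j).
Proof.
by rewrite /perm_val /= (nth_map j) ?size_enum_ord // nth_ord_enum.
Qed.

(** All [k] are covered because [le_val_sum] wants sequences in [K] on the whole of [nat]; beyond
    [n] the default [zero] appears. *)
Lemma perm_val_in (K : set U) X s (k : nat) :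
  K zero -> cartesian_power K X -> K (perm_val zero X s k).
Proof.
move=> K0 KX; have [lt_kn|le_nk] := ltnP k n.+1; last first.
  by rewrite /perm_val nth_default //= size_map size_enum_ord.
case: k lt_kn => [//|k]; rewrite ltnS => lt_kn.
by rewrite (perm_valS X s (Ordinal lt_kn)).
Qed.

Lemma perm_val_sorted X s (k : nat) : (forall i, (zero <= X i)%O) ->
  s \in sorting_perms X -> (k < n)%N ->
  (perm_val zero X s k <= perm_val zero X s k.+1)%O.
Proof.
rewrite inE => X_ge0 sX lt_kn; apply: sorted_leq_nth; rewrite ?inE //=.
- exact: le_trans.
- have: all (>= zero)%O (perm_vals X s) by apply/allP => _ /mapP[j _ ->].
  by case: (perm_vals X s) sX => //= x r -> /andP[->].
- by rewrite size_map size_enum_ord ltnS ltnW.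
- by rewrite size_map size_enum_ord.
Qed.

Lemma perm_val_le X Z s (k : nat) : le_vec X Z -> (k <= n)%N ->
  (perm_val zero X s k <= perm_val zero Z s k)%O.
Proof.
move=> leXZ; case: k => [//|k] lt_kn.
by rewrite !(perm_valS _ s (Ordinal lt_kn)).
Qed.

Lemma perm_tail_sub s (k : nat) : perm_tail s k.+1 \subset perm_tail s k.
Proof.
apply: finset.imsetS; apply/fintype.subsetP=> j; rewrite !inE.
exact: ltnW.
Qed.

Lemma perm_tail_last s : perm_tail s n.+1 = finset.set0.
Proof.
apply/finset.setP=> i; rewrite [RHS]inE; apply/imsetP=> -[j].
by rewrite inE ltnS leqNgt ltn_ord.
Qed.

Lemma exists_sorted_perm (leT : rel 'I_n) : total leT ->
  exists s : 'S_n, sorted leT [seq s j | j <- enum 'I_n].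
Proof.
move=> leT_total.
have /tuple_permP[s Ds]: perm_eq (sort leT (enum 'I_n)) (ord_tuple n).
  by rewrite perm_sort val_ord_tuple.
exists s; move: (sort_sorted leT_total (enum 'I_n)); rewrite Ds.
by congr sorted; apply: eq_map => j; rewrite tnth_ord_tuple.
Qed.

Lemma sorting_permE X s :
  (s \in sorting_perms X) =
  sorted (relpre X <=%O) [seq s j | j <- enum 'I_n].
Proof. by rewrite inE -sorted_map -map_comp. Qed.

Lemma exists_sorting_perm X : exists s, s \in sorting_perms X.
Proof.
have [|s] := @exists_sorted_perm (relpre X <=%O).
  by move=> i j; apply: le_total.
by rewrite -sorting_permE; exists s.
Qed.

(* A permutation that sorts i |-> X i + Z i sorts both X and Z. *)
Lemma exists_common_sorting_perm (add : SemiGroup.com_law U) X Z :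
    lt_compatible add ->
    (forall i j, (X i < X j)%O -> (Z i <= Z j)%O) ->
  exists2 s, s \in sorting_perms X & s \in sorting_perms Z.
Proof.
move=> addP comon; have [s] := exists_sorting_perm (fun i => add (X i) (Z i)).
have add_lt i j : (X i <= X j)%O -> (Z i <= Z j)%O ->
    ((X i < X j) || (Z i < Z j))%O -> (add (X i) (Z i) < add (X j) (Z j))%O.
  move=> leX leZ /orP[ltX|ltZ].
    by apply: lt_le_trans (addP _ _ _ ltX) _; rewrite le_addr.
  apply: (@le_lt_trans _ _ (add (X j) (Z i))); first by rewrite le_addl.
  by rewrite ![add (X j) _]SemiGroup.opC addP.
(* By contraposition: a strict descent of [X] or of [Z] forces a weak descent of the other, hence a
   strict descent of the sums. *)
rewrite sorting_permE => s_sorted; exists s; rewrite sorting_permE;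
  apply: sub_sorted s_sorted => i j /=; apply: contraTT; rewrite -!ltNge => lt_ji.
  by rewrite add_lt ?lt_ji ?(ltW lt_ji) ?comon.
rewrite add_lt ?lt_ji ?(ltW lt_ji) ?orbT //.
by rewrite leNgt; apply: contraTN lt_ji => /comon; rewrite leNgt.
Qed.

End SortingPermutations.

(** * Intermediate vectors between X and Z *)

Section Thresholds.
Variables (d : Order.disp_t) (U : orderType d) (n : nat) (X Z : 'I_n -> U).
Hypothesis leXZ : le_vec X Z.

(** This clamps [w] to the interval from [X i] to [Z i], so that the vector moves from [X] to [Z] as
    [w] grows. *)
Definition threshold (w : U) (i : 'I_n) : U :=
  Order.min (Z i) (Order.max (X i) w).

Lemma threshold_in (K : set U) (w : U) :
  K w -> cartesian_power K X -> cartesian_power K Z ->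
  cartesian_power K (threshold w).
Proof.
by move=> Kw KX KZ i; rewrite /threshold; case: leP => _ //; case: leP.
Qed.

Lemma threshold_low (w : U) : (forall i, (w <= X i)%O) -> threshold w = X.
Proof.
by move=> le_wX; apply/funext=> i; rewrite /threshold max_l // min_r.
Qed.

Lemma threshold_high (w : U) : (forall i, (Z i <= w)%O) -> threshold w = Z.
Proof.
move=> le_Zw; apply/funext=> i; rewrite /threshold min_l //.
by rewrite le_max le_Zw orbT.
Qed.

Lemma le_threshold (w w' : U) :
  (w <= w')%O -> le_vec (threshold w) (threshold w').
Proof.
move=> le_ww' i; rewrite /threshold le_min ge_min lexx /=.
by rewrite ge_min ge_max !le_max lexx le_ww' !orbT.
Qed.

Lemma threshold_comonotone (w w' : U) : (w <= w')%O ->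
    (forall i, (X i <= w)%O || (w' <= X i)%O) ->
    (forall i, (Z i <= w)%O || (w' <= Z i)%O) ->
  forall i j, (threshold w i < threshold w j)%O ->
    (threshold w' i <= threshold w' j)%O.
Proof.
(* With no value between w and w', passing from w to w' fixes the entries
   outside [w, w'[ and raises the others from w to w'. *)
move=> le_ww' gapX gapZ i j.
have thr k : threshold w' k = threshold w k /\
      ((threshold w k <= w)%O || (w' <= threshold w k)%O)
    \/ threshold w k = w /\ threshold w' k = w'.
  rewrite /threshold; have [le_Xw|le_w'X] := orP (gapX k); last first.
    rewrite !max_l ?(le_trans le_ww') //; left; split=> //.
    by rewrite min_r // le_w'X orbT.
  rewrite !max_r ?(le_trans le_Xw) //.
  have [le_Zw|le_w'Z] := orP (gapZ k).
    by left; rewrite !min_l ?(le_trans le_Zw) // le_Zw.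
  by right; rewrite !min_r ?(le_trans le_ww').
(* The gap matters only when [i] is raised and [j] is fixed: an entry above [w] is then at least
   [w']. *)
have [[-> gapi]|[-> ->]] := thr i; have [[-> gapj]|[-> ->]] := thr j.
- exact: ltW.
- by move=> /ltW /le_trans; apply.
- by case/orP: gapj => // le_jw; rewrite ltNge le_jw.
- by rewrite ltxx.
Qed.

End Thresholds.

(** * Capacities with prescribed values on a chain of tails *)

Section ChainCapacity.
Variables (R : realType) (n : nat) (g : nat -> R).

(* The least k such that C contains all indices from k on. *)
Definition tail_start (C : {set 'I_n}) : nat := \max_(j in ~: C) j.+1.

(** Each set gets the value of the largest tail it contains, so [g] can be prescribed freely along
    the chain, up to monotonicity and its end values. *)
Definition chain_capacity (C : {set 'I_n}) : R := g (tail_start C).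

Lemma tail_start_perm_tail (k : nat) : (k <= n)%N ->
  tail_start (perm_tail 1%g k.+1) = k.
Proof.
have in_tail (j : 'I_n) : (j \in ~: perm_tail 1%g k.+1) = (j < k)%N.
  rewrite inE ltnNge; congr (~~ _); apply/imsetP/idP => [[i le_ki ->]|le_kj].
    by rewrite perm1; rewrite inE in le_ki.
  by exists j; rewrite ?perm1 // inE.
move=> le_kn; apply/eqP; rewrite eqn_leq; apply/andP; split.
  by apply/bigmax_leqP=> j; rewrite in_tail.
case: k le_kn in_tail => // k lt_kn in_tail.
by apply: (@bigop.leq_bigmax_cond _ _ _ (Ordinal lt_kn)); rewrite in_tail /=.
Qed.

Lemma chain_capacityP : g 0%N = 1 -> g n = 0 ->
    {homo g : i j / (i <= j)%N >-> j <= i} -> capacity chain_capacity.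
Proof.
move=> g0 gn g_decr; have le_n C : (tail_start C <= n)%N.
  by apply/bigmax_leqP=> j _.
split=> [C|C D sCD||].
- by rewrite /unit_itv /= -g0 -gn !g_decr.
- apply: g_decr; apply/bigmax_leqP=> j; rewrite inE => notDj.
  apply: (@bigop.leq_bigmax_cond _ _ (fun j : 'I_n => j.+1) j).
  by rewrite inE; apply: contra notDj; apply: fintype.subsetP.
(* The empty set is the tail past [n], so its [tail_start] is [n], where [g] vanishes. *)
- have <- : perm_tail 1%g n.+1 = finset.set0 :> {set 'I_n} := perm_tail_last _.
  by rewrite /chain_capacity tail_start_perm_tail.
- rewrite /chain_capacity /tail_start finset.setCT big_pred0 // => j.
  by rewrite inE.
Qed.

End ChainCapacity.

(** * From the operator to sequences of values *)

Section Equivalence.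
Variables (R : realType) (d : Order.disp_t) (U : orderType d).
Variables (add : SemiGroup.com_law U) (K : set U) (zero one : U).
Variables (n : nat) (L : U -> U -> R -> R -> U).
Hypotheses (K0 : K zero) (le0K : forall x, K x -> (zero <= x)%O).
Hypotheses (leK1 : forall x, K x -> (x <= one)%O) (n_gt0 : (0 < n)%N).
Hypothesis add_compatible : lt_compatible add.

(** The weights are shifted because tails are counted from 1 while [tail_start] counts from 0: the
    [k]-th tail starts at [k.-1]. *)
Lemma C_op_chain (g : nat -> R) (a : nat -> U) : a 0%N = zero ->
  C_op add zero L 1%g (fun i : 'I_n => a i.+1) (chain_capacity g) =
  val_sum add L (fun k => g k.-1) n a.
Proof.
move=> a0; rewrite /C_op /val_sum /semigroup_sum.
have perm_valE k : (k <= n)%N -> perm_val zero (fun i : 'I_n => a i.+1) 1%g k = a k.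
  case: k => [//|k] lt_kn.
  by rewrite (perm_valS _ _ _ (Ordinal lt_kn)) perm1.
have term k : (0 < k <= n)%N ->
    L (perm_val zero (fun i : 'I_n => a i.+1) 1%g k)
      (perm_val zero (fun i : 'I_n => a i.+1) 1%g k.-1)
      (chain_capacity g (perm_tail (1%g : 'S_n) k))
      (chain_capacity g (perm_tail (1%g : 'S_n) k.+1)) =
    L (a k) (a k.-1) (g k.-1) (g k).
  case: k => [//|k] /= lt_kn; rewrite /chain_capacity.
  by rewrite !tail_start_perm_tail ?perm_valE // ltnW.
rewrite term ?n_gt0 ?leqnn //; apply: eq_big_nat => i /andP[i_gt0 lt_in].
by rewrite term // i_gt0 ltnW.
Qed.

Lemma sorting_perm_id (a : nat -> U) :
  {homo a : i j / (i <= j)%N >-> (i <= j)%O} ->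
  1%g \in sorting_perms (fun i : 'I_n => a i.+1).
Proof.
move=> a_incr; rewrite inE /perm_vals.
rewrite (_ : map _ _ = map (a \o succn) (map val (enum 'I_n))); last first.
  by rewrite -map_comp; apply: eq_map => j /=; rewrite perm1.
rewrite val_enum_ord; apply: (homo_sorted (e := leq)) (iota_sorted _ _).
by move=> i j le_ij; apply: a_incr.
Qed.

(** This is how necessity exploits the monotonicity condition: sorted sequences and decreasing
    weights can be chosen at will, with the identity as sorting permutation. *)
Lemma le_val_sum_chain (g : nat -> R) (a a' : nat -> U) :
    (forall X Z : 'I_n -> U, cartesian_power K X -> cartesian_power K Z ->
       le_vec X Z -> forall (s t : 'S_n) (mu : {set 'I_n} -> R),
       s \in sorting_perms X -> t \in sorting_perms Z -> capacity mu ->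
       (C_op add zero L s X mu <= C_op add zero L t Z mu)%O) ->
    g 0%N = 1 -> g n = 0 -> {homo g : i j / (i <= j)%N >-> j <= i} ->
    a 0%N = zero -> a' 0%N = zero ->
    (forall i, K (a i)) -> (forall i, K (a' i)) ->
    {homo a : i j / (i <= j)%N >-> (i <= j)%O} ->
    {homo a' : i j / (i <= j)%N >-> (i <= j)%O} ->
    (forall i, (a i <= a' i)%O) ->
  (val_sum add L (fun k => g k.-1) n a <= val_sum add L (fun k => g k.-1) n a')%O.
Proof.
move=> C_mono g0 gn g_decr a0 a'0 Ka Ka' a_incr a'_incr le_aa'.
rewrite -!C_op_chain //; apply: C_mono; try exact: sorting_perm_id.
- by move=> i; apply: Ka.
- by move=> i; apply: Ka'.
- by move=> i; apply: le_aa'.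
- exact: chain_capacityP.
Qed.

(** * Sufficiency *)

Hypothesis mono_mid :
  forall (u v : U) (b1 b2 b3 : R), K u -> K v -> (u <= v)%O ->
    unit_itv b1 -> unit_itv b2 -> unit_itv b3 -> b3 <= b2 -> b2 <= b1 ->
    nondecreasing_on (itv_in K u v)
      (fun x => add (L x u b1 b2) (L v x b2 b3)).
Hypothesis mono_last : forall (u : U) (b : R), K u -> unit_itv b ->
  nondecreasing_on (itv_in K u one) (fun x => L x u b 0).

(** A common permutation gives both vectors the same tails, hence the same weights, so [le_val_sum]
    applies. *)
Lemma le_C_op_same_perm (X Z : 'I_n -> U) (s : 'S_n) (mu : {set 'I_n} -> R) :
    cartesian_power K X -> cartesian_power K Z -> le_vec X Z -> capacity mu ->
    s \in sorting_perms X -> s \in sorting_perms Z ->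
  (C_op add zero L s X mu <= C_op add zero L s Z mu)%O.
Proof.
move=> KX KZ leXZ [mu01 mu_incr mu0 _] sX sZ.
apply: (le_val_sum add_compatible n_gt0 leK1 mono_mid mono_last
  (w := fun k => mu (perm_tail s k))) => //= [k||k|k|k lt_kn|k lt_kn|k].
- by apply: mu_incr; apply: perm_tail_sub.
- by rewrite perm_tail_last.
- exact: perm_val_in.
- exact: perm_val_in.
- by apply: perm_val_sorted => // i; apply/le0K/KX.
- by apply: perm_val_sorted => // i; apply/le0K/KZ.
- exact: perm_val_le.
Qed.

(** Induction on the thresholds [ws] still to come. As every entry of [X] and [Z] is at most [w] or
    in [ws], none lies strictly between [w] and the next threshold, and when [ws] is empty the
    vector is [Z]. *)
Lemma le_C_op_threshold (X Z : 'I_n -> U) (mu : {set 'I_n} -> R)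
    (ws : seq U) (w : U) (s t : 'S_n) :
    C_well_defined add K zero L n ->
    cartesian_power K X -> cartesian_power K Z -> le_vec X Z -> capacity mu ->
    K w -> (forall v, v \in ws -> K v) -> path <=%O w ws ->
    (forall i, (X i <= w)%O || (X i \in ws)) ->
    (forall i, (Z i <= w)%O || (Z i \in ws)) ->
    s \in sorting_perms (threshold X Z w) -> t \in sorting_perms Z ->
  (C_op add zero L s (threshold X Z w) mu <= C_op add zero L t Z mu)%O.
Proof.
move=> wd KX KZ leXZ mu_cap; elim: ws w s => [|w' ws IHws] w s Kw Kws /=.
  move=> _ _ le_Zw; have {le_Zw} -> : threshold X Z w = Z.
    by apply: threshold_high => i; have := le_Zw i; rewrite orbF.
  by move=> sZ tZ; rewrite (wd Z mu KZ mu_cap s t).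
case/andP=> le_ww' path_ws inX inZ sX tZ.
have gap v : (v <= w)%O || (v \in w' :: ws) -> (v <= w)%O || (w' <= v)%O.
  case/orP=> [-> //|]; rewrite inE => /predU1P[->|v_ws]; first by rewrite lexx orbT.
  by have /allP/(_ v v_ws) -> := order_path_min le_trans path_ws; rewrite orbT.
have next v : (v <= w)%O || (v \in w' :: ws) -> (v <= w')%O || (v \in ws).
  case/orP=> [le_vw|]; first by rewrite (le_trans le_vw).
  by rewrite inE => /predU1P[->|->]; rewrite ?lexx ?orbT.
have Kw' : K w' by apply: Kws; rewrite mem_head.
have [s' sw sw'] := exists_common_sorting_perm add_compatible
  (threshold_comonotone leXZ le_ww' (fun i => gap _ (inX i)) (fun i => gap _ (inZ i))).
have Kthr v : K v -> cartesian_power K (threshold X Z v).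
  by move=> Kv; apply: threshold_in.
(* Well-definedness trades [s] for [s'], which sorts the next vector too. *)
rewrite (wd _ mu (Kthr w Kw) mu_cap s s' sX sw).
apply: le_trans (le_C_op_same_perm (Kthr w Kw) (Kthr w' Kw')
  (le_threshold _ _ le_ww') mu_cap sw sw') _.
apply: IHws => // [v v_ws|i|i].
- by apply: Kws; rewrite inE v_ws orbT.
- exact/next/inX.
- exact/next/inZ.
Qed.

Lemma le_C_op (X Z : 'I_n -> U) (s t : 'S_n) (mu : {set 'I_n} -> R) :
    C_well_defined add K zero L n ->
    cartesian_power K X -> cartesian_power K Z -> le_vec X Z -> capacity mu ->
    s \in sorting_perms X -> t \in sorting_perms Z ->
  (C_op add zero L s X mu <= C_op add zero L t Z mu)%O.
Proof.
move=> wd KX KZ leXZ mu_cap sX tZ.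
have thr0 : threshold X Z zero = X by apply: threshold_low => // i; apply/le0K/KX.
pose ws := sort <=%O (codom X ++ codom Z).
have Kws v : v \in ws -> K v.
  by rewrite mem_sort mem_cat => /orP[] /codomP[i ->].
(* The chain starts at [zero], below all entries, where the threshold vector is [X]. *)
rewrite -{1}thr0; apply: (@le_C_op_threshold _ _ _ ws) => //.
- rewrite path_sortedE ?sort_le_sorted ?andbT; last exact: le_trans.
  by apply/allP=> v /Kws/le0K.
- by move=> i; rewrite mem_sort mem_cat codom_f orbT.
- by move=> i; rewrite mem_sort mem_cat codom_f !orbT.
- by rewrite thr0.
Qed.

End Equivalence.

(** * Necessity by test vectors, and the equivalence *)

Theorem theorem3p8 (R : realType) (d : Order.disp_t) (U : orderType d)
    (lep : rel U) (add : SemiGroup.com_law U) (K : set U) (zero one : U)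
    (n : nat) (L : U -> U -> R -> R -> U)
    (lep_order : partial_order lep)
    (le_admissible : admissible lep)
    (zero_least : least_in lep K zero)
    (one_greatest : greatest_in lep K one)
    (zero_neq_one : zero <> one)
    (n_ge4 : (4 <= n)%N)
    (L_in_K : forall (x y : U) (a b : R), K x -> K y ->
      unit_itv a -> unit_itv b -> K (L x y a b))
    (add_compatible : lt_compatible add) :
  (forall X Z : 'I_n -> U, cartesian_power K X -> cartesian_power K Z -> le_vec X Z ->
     forall (s t : 'S_n) (mu : {set 'I_n} -> R),
       s \in sorting_perms X -> t \in sorting_perms Z -> capacity mu ->
       (C_op add zero L s X mu <= C_op add zero L t Z mu)%O)
  <->
  [/\ C_well_defined add K zero L n,
      forall (u v : U) (b1 b2 b3 : R), K u -> K v -> (u <= v)%O ->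
        unit_itv b1 -> unit_itv b2 -> unit_itv b3 -> b3 <= b2 -> b2 <= b1 ->
        nondecreasing_on (itv_in K u v)
          (fun x => add (L x u b1 b2) (L v x b2 b3)) &
      forall (u : U) (b : R), K u -> unit_itv b ->
        nondecreasing_on (itv_in K u one) (fun x => L x u b 0)].
Proof.
have [K0 le0K] : K zero /\ forall x, K x -> (zero <= x)%O.
  by case: zero_least => K0 le0; split=> // x /le0/le_admissible.
have leK1 x : K x -> (x <= one)%O.
  by case: one_greatest => _ le1 /le1/le_admissible.
have n_gt0 : (0 < n)%N by apply: leq_trans n_ge4.
split=> [C_mono|[wd mono_mid mono_last] X Z KX KZ leXZ s t mu sX tZ mu_cap];
  last exact: (le_C_op _ _ leK1).
split.
- move=> X mu KX mu_cap s t sX tX.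
  (* Monotonicity from [X] to itself, with [s] and [t] in either role. *)
  by apply: le_anti; rewrite !C_mono.
- move=> u v b1 b2 b3 Ku Kv le_uv b1_01 b2_01 b3_01 le_b32 le_b21 x y.
  rewrite !inE => -[Kx /andP[le_ux le_xv]] [Ky /andP[le_uy le_yv]] le_xy.
  (* Position 2 is varied, as the first tail has forced weight 1. Its two terms use [g 1], [g 2],
     [g 3], that is [b1], [b2], [b3]; [n_ge4] keeps index 3 below [n], where [g] drops to 0. The
     defaults of [nth] repeat [b3] and [v]. *)
  pose g k := if (n <= k)%N then 0 else nth b3 [:: 1; b1; b2] k.
  pose a z k := nth v [:: zero; u; z] k.
  have g_decr k : g k.+1 <= g k.
    rewrite /g; have [le_nSk|lt_Skn] := leqP n k.+1; last first.
      rewrite leqNgt (ltnW lt_Skn) /=.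
      by case: k {lt_Skn} => [|[|[|k]]] //=; rewrite ?nth_nil //; case/andP: b1_01.
    case: ifP => // _.
    have [b1_ge0 b2_ge0 b3_ge0] : [/\ 0 <= b1, 0 <= b2 & 0 <= b3].
      by split; [case/andP: b1_01 | case/andP: b2_01 | case/andP: b3_01].
    by case: k {le_nSk} => [|[|[|k]]] //=; rewrite ?nth_nil.
  have a_incr z : (u <= z)%O -> (z <= v)%O ->
      {homo a z : i j / (i <= j)%N >-> (i <= j)%O}.
    move=> le_uz le_zv; apply: (homo_leq lexx le_trans) => -[|[|[|k]]] //=.
      exact: le0K.
    by rewrite /a /= nth_nil.
  have a_in z : K z -> forall k, K (a z k).
    by move=> Kz [|[|[|k]]]; rewrite /a /= ?nth_nil.
  have : (val_sum add L (fun k => g k.-1) n (a x)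
          <= val_sum add L (fun k => g k.-1) n (a y))%O.
    apply: (le_val_sum_chain n_gt0 C_mono); try exact: a_in; try exact: a_incr.
    + by rewrite /g leqNgt n_gt0.
    + by rewrite /g leqnn.
    + exact: (homo_leq (r := fun p q => q <= p) lexx
        (fun _ _ _ p q => le_trans q p)).
    + by [].
    + by [].
    + by move=> [|[|[|k]]]; rewrite /a /= ?nth_nil.
  rewrite (@le_val_sum_update _ _ _ _ _ add_compatible _ _ 2) //=; first last.
  - by move=> [|[|[|k]]].
  - by rewrite (leq_trans _ n_ge4).
  by rewrite /g /= [(n <= 3)%N]leqNgt n_ge4 ![(n <= _)%N]leqNgt
    (leq_trans _ n_ge4) // (leq_trans _ n_ge4).
- move=> u b Ku b_01 x y.
  rewrite !inE => -[Kx /andP[le_ux _]] [Ky /andP[le_uy _]] le_xy.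
  have n_gt1 : (1 < n)%N by apply: leq_trans n_ge4.
  have n_pred : (n.-1 < n)%N by rewrite prednK.
  (* Only the last value is varied: its term has weights [g n.-1 = b] and [g n = 0], and predecessor
     [u]. Since [n.-1] is positive, it avoids the forced entries 1 and [zero] at index 0. *)
  pose g k := if (n <= k)%N then 0 else nth b [:: 1] k.
  pose a z k := if (n <= k)%N then z else nth u [:: zero] k.
  have g_decr k : g k.+1 <= g k.
    rewrite /g; have [le_nSk|lt_Skn] := leqP n k.+1; last first.
      rewrite leqNgt (ltnW lt_Skn) /=.
      by case: k lt_Skn => [|k] //= _; rewrite ?nth_nil //; case/andP: b_01.
    case: ifP => // _.
    by case: k {le_nSk} => [|k] //=; rewrite ?nth_nil //; case/andP: b_01.
  have a_incr z : (u <= z)%O ->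
      {homo a z : i j / (i <= j)%N >-> (i <= j)%O}.
    move=> le_uz; apply: (homo_leq lexx le_trans) => k; rewrite /a.
    have [le_nSk|lt_Skn] := leqP n k.+1; last first.
      rewrite leqNgt (ltnW lt_Skn) /=.
      by case: k {lt_Skn} => [|k] //=; rewrite ?nth_nil // le0K.
    case: ifP => // _; case: k {le_nSk} => [|k] /=; last by rewrite ?nth_nil.
    by rewrite (le_trans _ le_uz) // le0K.
  have a_in z : K z -> forall k, K (a z k).
    by move=> Kz k; rewrite /a; case: ifP => // _; case: k => [|k] //=; rewrite ?nth_nil.
  have : (val_sum add L (fun k => g k.-1) n (a x)
          <= val_sum add L (fun k => g k.-1) n (a y))%O.
    apply: (le_val_sum_chain n_gt0 C_mono); try exact: a_in; try exact: a_incr.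
    + by rewrite /g leqNgt n_gt0.
    + by rewrite /g leqnn.
    + exact: (homo_leq (r := fun p q => q <= p) lexx
        (fun _ _ _ p q => le_trans q p)).
    + by rewrite /a leqNgt n_gt0.
    + by rewrite /a leqNgt n_gt0.
    + by move=> k; rewrite /a; case: ifP.
  rewrite (le_val_sum_last _ add_compatible) //; last first.
    by move=> k lt_kn; rewrite /a leqNgt lt_kn.
  rewrite /g /a /= leqnn leqNgt n_pred /=.
  by case: (n) n_gt1 => [|[|m]] //= _; rewrite ?nth_nil.
Qed.
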